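(* Let $k\ge 2$ be an integer. For a large real number $P$, let $V_k(P)$ denote the number of integral solutions $\mathbf z=(z_1,\ldots,z_{2k+2})$ of the system $\sum_{i=1}^{2k+2}z_i^{2j-1}=0$ $(1\le j\le k)$ with $|z_i|\le P$ $(1\le i\le 2k+2)$. Let $L_k(P)$ denote the number of such solutions lying on one of the $c_k=\prod_{j=1}^{k+1}(2j-1)$ linear spaces obtained from $z_{2i-1}+z_{2i}=0$ $(1\le i\le k+1)$ by permuting the indices $\{1,\ldots,2k+2\}$ (the trivial solutions). Define $\alpha_k=\min_{r\in\mathbb N,\,2\le r\le 2k+1}\bigl(r-1+\frac{2k+2}{r}\bigr)$. Then for each $\varepsilon>0$ one has $V_k(P)-L_k(P)\ll P^{\alpha_k+\varepsilon}$, and in particular $V_k(P)-L_k(P)\ll P^{\sqrt{8k+9}-1+\varepsilon}$.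
   Context: Implicit constants depend at most on $\varepsilon$ and $k$. One has $L_k(P)=c_k(2P+1)^{k+1}+O(P^k)$. *)

(* Defs.v *)
From mathcomp Require Export all_boot all_order all_algebra perm finmap.
From mathcomp Require Export all_classical all_reals all_analysis.
Set Implicit Arguments.
Unset Strict Implicit.
Unset Printing Implicit Defensive.
Export Order.TTheory GRing.Theory Num.Theory.
Export numFieldNormedType.Exports.

Local Open Scope classical_set_scope.
Local Open Scope ring_scope.

(* z_1, ..., z_(2k+2) are indexed from 0: z_i is [z (inord i.-1)].            *)
Definition ivec (k : nat) := {ffun 'I_(2 * k).+2 -> int}.

Definition in_box (R : realType) (k : nat) (P : R) : set (ivec k) :=
  [set z : ivec k | forall i, `|z i|%:~R <= P].

Definition odd_system (k : nat) : set (ivec k) :=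
  [set z : ivec k | forall j : nat, (1 <= j <= k)%N ->
     \sum_i z i ^+ (2 * j - 1) = 0].

(* The (integral points of the) linear space obtained from
   z_(2i-1) + z_(2i) = 0, 1 <= i <= k+1, by the permutation s of the indices. *)
Definition paired_space (k : nat) (s : 'S_(2 * k).+2) : set (ivec k) :=
  [set z : ivec k | forall i : nat, (1 <= i <= k.+1)%N ->
     z (s (inord (2 * i - 1).-1)) + z (s (inord (2 * i).-1)) = 0].

Definition solutions (R : realType) (k : nat) (P : R) : set (ivec k) :=
  @odd_system k `&` in_box P.

(* Different s may give the same space; a solution is counted once
   however many of the spaces it lies on.                                     *)
Definition trivial_solutions (R : realType) (k : nat) (P : R) : set (ivec k) :=
  solutions P `&` \bigcup_s paired_space s.

(* [fset_set] is only meaningful on finite sets: see [finite_solutions] and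
   [finite_trivial_solutions] below.                                          *)
Definition V (R : realType) (k : nat) (P : R) : nat :=
  #|` fset_set (@solutions R k P)|.

Definition L (R : realType) (k : nat) (P : R) : nat :=
  #|` fset_set (@trivial_solutions R k P)|.

Definition alpha_term (R : realType) (k r : nat) : R :=
  r%:R - 1 + (2 * k + 2)%:R / r%:R.

(* For k >= 1 the index r = 2 of the default value lies in the range.         *)
Definition alpha (R : realType) (k : nat) : R :=
  \big[Num.min/alpha_term R k 2]_(2 <= r < (2 * k + 1).+1) alpha_term R k r.

Lemma finite_in_box (R : realType) (k : nat) (P : R) :
  finite_set (@in_box R k P).
Proof.
pose N := `|Num.floor P|%N.
pose g (f : {ffun 'I_(2 * k).+2 -> 'I_(2 * N).+1}) : ivec k :=
  [ffun i => (f i)%:Z - N%:Z].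
apply: (@sub_finite_set _ _ (range g)); last exact/finite_image/finite_finset.
move=> z zP; exists [ffun i => inord (absz (z i + N%:Z)%R)] => //.
apply/ffunP => i; rewrite !ffunE.
have zN : `|z i| <= N%:Z.
  have := zP i; rewrite -floor_ge_int => h.
  by rewrite /N abszE (le_trans h)// ler_norm.
move: zN; rewrite ler_norml => /andP[zN1 zN2].
move: (z i) zN1 zN2 => x xN1 xN2.
have x0 : 0 <= x + N%:Z by rewrite addrC -lerBlDl sub0r.
rewrite inordK; first by rewrite gez0_abs// addrK.
by rewrite ltnS -lez_nat gez0_abs// mul2n -addnn PoszD lerD2r.
Qed.

Lemma finite_solutions (R : realType) (k : nat) (P : R) :
  finite_set (@solutions R k P).
Proof. by apply: sub_finite_set (@finite_in_box R k P) => z []. Qed.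

Lemma finite_trivial_solutions (R : realType) (k : nat) (P : R) :
  finite_set (@trivial_solutions R k P).
Proof. by apply: sub_finite_set (@finite_solutions R k P) => z []. Qed.

Lemma alpha_le (R : realType) (k r : nat) :
  (2 <= r <= 2 * k + 1)%N -> alpha R k <= alpha_term R k r.
Proof.
move=> rk; apply: ge_bigmin_seq => //.
by rewrite mem_index_iota ltnS.
Qed.

Lemma alpha_attained (R : realType) (k : nat) : (1 <= k)%N ->
  exists2 r : nat, (2 <= r <= 2 * k + 1)%N & alpha R k = alpha_term R k r.
Proof.
move=> k1; rewrite /alpha big_seq.
elim/big_ind: _ => [|x y [r rk ->] [s sk ->]|r].
- by exists 2%N => //; rewrite /= addn1 ltnS mul2n -addnn (leq_trans k1)// leq_addr.
- by rewrite /Num.min; case: ifP => _; [exists r | exists s].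
- by rewrite mem_index_iota ltnS => rk; exists r.
Qed.

(* Main.v *)
From mathcomp Require Import ring lra zify.
Require Import Defs.
Set Implicit Arguments.
Unset Strict Implicit.
Unset Printing Implicit Defensive.
Local Open Scope classical_set_scope.
Local Open Scope ring_scope.

(** Let n = 2k+2. The vanishing of the first k odd power sums means that
    \prod (X + z_i) - \prod (X - z_i) = c X for a constant c, so that
    2 \prod_(i <> j) (z_i + z_j) = c for every j, and c = 0 exactly when the
    z_i cancel in pairs. Fix a nontrivial solution and r coordinates
    z_0, ..., z_(r-1) with distinct values (if there are fewer than r values,
    there are only O(P^(r-1)) choices). Go through the remaining coordinates
    one at a time, and call a prime new at (i, p), p < r <= i, if it divides
    z_i + z_p but none of the sums and differences formed from the previous
    coordinates. A prime is new at most once, and the new primes divide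
    \prod_(i >= r) (z_i + z_0), so their product is O(P^(n-r)) and for some p
    the product b of the primes new at some (i, p) is O(P^((n-r)/r)). Given
    z_0, ..., z_(r-1), p and b, every prime factor of z_i + z_p divides a known
    integer, which leaves O(P^eps) possibilities for each further z_i. This
    gives O(P^(r + (n-r)/r + eps)) = O(P^(r - 1 + n/r + eps)) solutions. *)

(** * The symmetric function identity *)

Definition prodXD (R : nzRingType) (s : seq R) : {poly R} :=
  \prod_(x <- s) ('X + x%:P).

Definition prodXB (R : nzRingType) (s : seq R) : {poly R} :=
  \prod_(x <- s) ('X - x%:P).

Lemma prodXD_opp (R : nzRingType) (s : seq R) :
  prodXD s = \prod_(x <- map -%R s) ('X - x%:P).
Proof. by rewrite big_map; apply: eq_bigr => x _; rewrite polyCN opprK. Qed.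

Lemma size_prodXD (R : nzRingType) (s : seq R) : size (prodXD s) = (size s).+1.
Proof. by rewrite prodXD_opp size_prod_XsubC size_map. Qed.

Lemma size_prodXB (R : nzRingType) (s : seq R) : size (prodXB s) = (size s).+1.
Proof. exact: size_prod_XsubC. Qed.

Lemma monic_prodXD (R : nzRingType) (s : seq R) : prodXD s \is monic.
Proof. by rewrite prodXD_opp monic_prod_XsubC. Qed.

Lemma monic_prodXB (R : nzRingType) (s : seq R) : prodXB s \is monic.
Proof. exact: monic_prod_XsubC. Qed.

Lemma horner_prodXD (R : comNzRingType) (s : seq R) (t : R) :
  (prodXD s).[t] = \prod_(x <- s) (t + x).
Proof. by rewrite horner_prod; apply: eq_bigr => x _; rewrite !hornerE. Qed.

Lemma horner_prodXB (R : comNzRingType) (s : seq R) (t : R) :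
  (prodXB s).[t] = \prod_(x <- s) (t - x).
Proof. by rewrite horner_prod; apply: eq_bigr => x _; rewrite !hornerE. Qed.

Lemma coefM_top (R : nzRingType) (p q : {poly R}) (a b : nat) :
  (size p <= a.+1)%N -> (size q <= b.+1)%N -> (p * q)`_(a + b) = p`_a * q`_b.
Proof.
move=> sp sq; rewrite coefM.
have ha : (a < (a + b).+1)%N by rewrite ltnS leq_addr.
rewrite (bigD1 (Ordinal ha)) //= addKn big1 ?addr0 // => i /negP ia.
have [lt|ge] := ltnP a i.
  by rewrite nth_default ?mul0r // (leq_trans sp).
have lt : (i < a)%N.
  rewrite ltn_neqAle ge andbT; apply/negP => /eqP e.
  by apply: ia; apply/eqP/val_inj.
rewrite [q`_ _]nth_default ?mulr0 //; apply: (leq_trans sq).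
by lia.
Qed.

(* Newton's identities, in the form of the expansion at infinity of
   A'/A - B'/B = - \sum_x 2x / (X^2 - x^2) for A = prodXD s, B = prodXB s. *)
Lemma wronskian_expansion (R : comNzRingType) (k : nat) (s : seq R) :
  exists2 Q : {poly R}, (size Q <= (2 * size s).-1)%N &
    'X^(2 * k) * ((prodXD s)^`() * prodXB s - prodXD s * (prodXB s)^`())
    = Q - 2%:R * (\sum_(m < k) (\sum_(x <- s) x ^+ (2 * m + 1))%:P
                         * 'X^(2 * (k.-1 - m))) * (prodXD s * prodXB s).
Proof.
elim: s => [|x s [Q sQ IH]].
  exists 0; first by rewrite size_poly0.
  rewrite /prodXD /prodXB !big_nil mulr1 mul1r.
  rewrite subrr mulr0 big1 ?mulr0 ?mul0r ?subr0 // => m _.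
  by rewrite big_nil mul0r.
have -> : prodXD (x :: s) = ('X + x%:P) * prodXD s by rewrite /prodXD big_cons.
have -> : prodXB (x :: s) = ('X - x%:P) * prodXB s by rewrite /prodXB big_cons.
have sAB : (size (prodXD s * prodXB s)%R <= 2 * size s + 1)%N.
  apply: leq_trans (size_polyMleq _ _) _.
  by rewrite size_prodXD size_prodXB addnS mul2n -addnn addn1.
move: (prodXD s) (prodXB s) IH sAB => A B IH sAB.
(* Adjoining [x] turns A'B - AB' into (X^2 - x^2)(A'B - AB') - 2xAB. After X^(2k) = (X^2 - x^2) T +
   x^(2k) is inserted in the last term, the part with [T] supplies the new terms of the sum, and the
   part with x^(2k) goes into this witness. *)
exists (('X^2 - (x ^+ 2)%:P) * Q - 2%:R * (x ^+ (2 * k + 1))%:P * (A * B)).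
  have sC : (size (2%:R * (x ^+ (2 * k + 1))%:P : {poly R})%R <= 1)%N.
    by rewrite -[2%:R]polyC_natr -polyCM size_polyC leq_b1.
  have -> : size (x :: s) = (size s).+1 by [].
  apply: leq_trans (size_polyD _ _) _; rewrite geq_max size_polyN.
  apply/andP; split; last first.
    have aux a b n : (a <= 1 -> b <= 2 * n + 1 -> (a + b).-1 <= (2 * n.+1).-1)%N.
      by lia.
    exact: leq_trans (size_polyMleq _ _) (aux _ _ _ sC sAB).
  have [->|Q0] := eqVneq Q 0; first by rewrite mulr0 size_poly0.
  apply: leq_trans (size_polyMleq _ _) _; rewrite size_XnsubC //.
  have aux q n : (0 < q -> q <= (2 * n).-1 -> (3 + q).-1 <= (2 * n.+1).-1)%N.
    by lia.
  by apply: aux sQ; rewrite size_poly_gt0.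
have -> : \sum_(m < k) (\sum_(y <- x :: s) y ^+ (2 * m + 1))%:P * 'X^(2 * (k.-1 - m))
  = \sum_(m < k) (\sum_(y <- s) y ^+ (2 * m + 1))%:P * 'X^(2 * (k.-1 - m))
    + x%:P * \sum_(m < k) ('X^2) ^+ (k.-1 - m) * ((x ^+ 2)%:P) ^+ m :> {poly R}.
  rewrite mulr_sumr -big_split /=; apply: eq_bigr => m _.
  rewrite big_cons polyCD mulrDl addrC; congr (_ + _).
  rewrite addn1 exprS exprM polyCM rmorphXn /= -mulrA; congr (_ * _).
  by rewrite -exprM mulrC.
have := subrXX ('X^2 : {poly R}) ((x ^+ 2)%:P) k.
rewrite -exprM -rmorphXn /= -exprM.
move: (\sum_(m < k) _ : {poly R}) IH (\sum_(m < k) _ : {poly R}) => S IH T G.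
have X2k : 'X^(2 * k) = (('X^2 : {poly R}) - (x ^+ 2)%:P) * T + (x ^+ (2 * k))%:P :> {poly R}.
  by rewrite -G subrK.
rewrite !derivM !poly.derivE addr0 subr0 !mul1r addn1 [x ^+ (2 * k).+1]exprS polyCM.
rewrite rmorphXn /= in X2k *.
transitivity (('X^2 - x%:P ^+ 2) * ('X^(2 * k) * (A^`() * B - A * B^`()))
              - 2%:R * x%:P * 'X^(2 * k) * (A * B)); first by ring.
by rewrite IH X2k; ring.
Qed.

(** With A = [prodXD s], B = [prodXB s] and W = A - B, the expansion bounds the degree of A'B - AB'
    = W'B - WB' by 2k + 2. If deg W were at least 2, that degree would be deg W + 2k + 1, because
    deg W < 2k + 2. So W is at most linear, and W(0) = 0 since [size s] is even. *)
Lemma prodXD_sub_prodXB (R : numDomainType) (k : nat) (s : seq R) :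
  size s = (2 * k).+2 ->
  (forall m, (m < k)%N -> \sum_(x <- s) x ^+ (2 * m + 1) = 0) ->
  exists c : R, prodXD s - prodXB s = c *: 'X.
Proof.
move=> ss hs.
have [Q sQ] := wronskian_expansion k s.
rewrite big1 ?mulr0 ?mul0r ?subr0; last first.
  by move=> m _; rewrite hs ?mul0r // ltn_ord.
set H := (_ - _) => HQ.
have sH : (size H <= (2 * k).+3)%N.
  have [->|H0] := eqVneq H 0; first by rewrite size_poly0.
  have := size_mulXn (2 * k) H0; rewrite mulrC HQ => e.
  have aux q h : (q = 2 * k + h -> q <= (2 * (2 * k).+2).-1 -> h <= (2 * k).+3)%N.
    by lia.
  by apply: aux e _; rewrite -ss.
have sA := size_prodXD s; have sB := size_prodXB s.
have mA := monic_prodXD s; have mB := monic_prodXB s.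
have W0 : (prodXD s - prodXB s).[0] = 0.
  rewrite !hornerE horner_prodXD horner_prodXB.
  under eq_bigr do rewrite add0r.
  under [X in _ - X]eq_bigr do rewrite add0r -mulN1r.
  rewrite big_split /= big_const_seq count_predT ss iter_mulr_1.
  by rewrite -signr_odd /= negbK mul2n odd_double expr0 mul1r subrr.
move: (prodXD s) (prodXB s) @H sA sB mA mB HQ sH W0 => A B H sA sB mA mB HQ sH W0.
set W := A - B in W0 *.
have HE : H = W^`() * B - W * B^`() by rewrite /H /W derivB; ring.
have sW : (size W <= (2 * k).+2)%N.
  have sW' : (size W <= (size s).+1)%N.
    by rewrite (leq_trans (size_polyD _ _)) // size_polyN sA sB maxnn.
  rewrite -ltnS -ss ltn_neqAle sW' andbT; apply/negP => /eqP e.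
  have := lead_coefE W; rewrite e /= coefB.
  move: mA mB => /monicP; rewrite lead_coefE sA /= => -> /monicP.
  rewrite lead_coefE sB /= => ->; rewrite subrr => /eqP.
  by rewrite lead_coef_eq0 -size_poly_eq0 e.
have W2 : (size W <= 2)%N.
  rewrite leqNgt; apply/negP => W3.
  pose d := (size W).-2.
  have eW : size W = d.+2 by rewrite /d; move: W3; case: (size W) => [|[|m]].
  (* [W] has degree [d + 1], and this coefficient of [H] equals [d + 1 - size s] times the leading
     coefficient of [W], which is nonzero by [sW]. *)
  have : H`_(d + size s) = 0.
    by apply: nth_default; apply: leq_trans sH _; move: W3; rewrite eW ss; lia.
  rewrite HE coefB coefM_top ?sB //; last first.
    by apply/leq_sizeP => j hj; rewrite coef_deriv nth_default ?mul0rn // eW.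
  have -> : (d + size s = d.+1 + (size s).-1)%N by rewrite ss; lia.
  rewrite coefM_top ?eW //; last first.
    apply/leq_sizeP => j hj.
    by rewrite coef_deriv nth_default ?mul0rn // sB ltnS; move: hj; rewrite ss.
  rewrite !coef_deriv; move: mB => /monicP; rewrite lead_coefE sB /= ss /= => ->.
  rewrite mulr_natr => /eqP; rewrite subr_eq0 => /eqP.
  have W1 : W`_d.+1 != 0.
    by have := lead_coefE W; rewrite eW /= => <-; rewrite lead_coef_eq0 -size_poly_eq0 eW.
  by rewrite mulr1 => /(mulrIn W1) e; move: sW; rewrite eW e ltnn.
exists W`_1; apply/polyP => i; rewrite coefZ coefX.
case: i => [|[|i]] /=; rewrite ?mulr1 ?mulr0 //.
  by rewrite -horner_coef0.
by rewrite nth_default // (leq_trans W2).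
Qed.

(** Evaluating A - B = cX at z_j kills B and leaves z_j times the claim. If z_j = 0, a factor X is
    cancelled first; at 0 the remaining products then differ by an odd number of signs, so their
    difference doubles. *)
Lemma prod_pair_sum (R : numDomainType) (s : seq R) (c : R) (j : nat) :
  ~~ odd (size s) -> prodXD s - prodXB s = c *: 'X -> (j < size s)%N ->
  2%:R * \prod_(i < size s | i != j :> nat) (s`_j + s`_i) = c.
Proof.
move=> es eW js; pose jj := Ordinal js.
pose A := \prod_(i < size s | i != jj) ('X + (s`_i)%:P).
pose B := \prod_(i < size s | i != jj) ('X - (s`_i)%:P).
have eA : prodXD s = ('X + (s`_j)%:P) * A.
  by rewrite /prodXD (big_nth 0) big_mkord (bigD1 jj).
have eB : prodXB s = ('X - (s`_j)%:P) * B.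
  by rewrite /prodXB (big_nth 0) big_mkord (bigD1 jj).
have hA t : A.[t] = \prod_(i < size s | i != jj) (t + s`_i).
  by rewrite horner_prod; apply: eq_bigr => i _; rewrite !hornerE.
rewrite -[LHS]/(2%:R * \prod_(i < size s | i != jj) (s`_j + s`_i)) -hA.
have [s0|s0] := eqVneq s`_j 0.
  move: eW; rewrite eA eB s0 subr0 addr0 -mulrBr -mul_polyC mulrC.
  move=> /(mulIf (negbT (polyX_eq0 _))) /(congr1 (horner^~ 0)).
  rewrite hornerD hornerN hornerC => <-.
  have -> : A.[0] = \prod_(i < size s | i != jj) s`_i.
    by rewrite hA; apply: eq_bigr => i _; rewrite add0r.
  rewrite horner_prod.
  under [X in _ - X]eq_bigr do rewrite hornerXsubC sub0r.
  rewrite (prodrN (fun i => i != jj)) cardC1 card_ord.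
  rewrite -signr_odd.
  have -> : odd (size s).-1 by move: es (js); case: (size s) => //= n /negbNE.
  by rewrite expr1 mulN1r opprK mulr2n mulrDl mul1r.
suff : s`_j * (2%:R * A.[s`_j]) = s`_j * c by move/(mulfI s0).
have := congr1 (horner^~ s`_j) eW.
rewrite /= eA eB hornerD hornerN !hornerM hornerXsubC subrr mul0r subr0.
rewrite hornerD hornerX hornerC hornerZ hornerX => e.
by rewrite mulrA mulr_natr mulr2n e mulrC.
Qed.

Lemma prod_pair_sum_eq0 (R : numDomainType) (s : seq R) (c : R) (a b : nat) :
  ~~ odd (size s) -> prodXD s - prodXB s = c *: 'X ->
  (a < size s)%N -> (b < size s)%N -> a != b -> s`_a + s`_b = 0 -> c = 0.
Proof.
move=> es eW ha hb ab h; rewrite -(prod_pair_sum es eW ha).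
rewrite (bigD1 (Ordinal hb)) /=; last by rewrite eq_sym.
by rewrite h mul0r mulr0.
Qed.

(** A nonzero entry x makes -x a root of [prodXD s], hence of [prodXB s], so -x is an entry too.
    Cancelling (X + x)(X - x) on both sides allows induction; if all entries vanish, any order
    works. *)
Lemma pairing_of_prodXD_eq (R : numDomainType) (m : nat) (s : seq R) :
  size s = (2 * m)%N -> prodXD s = prodXB s ->
  exists2 t, perm_eq t s & forall i, (i < m)%N -> t`_(2 * i) + t`_(2 * i).+1 = 0.
Proof.
elim: m s => [|m IH] s ss eW; first by exists s.
have [/allP s0|/allPn [x xs x0]] := boolP (all (pred1 0) s).
  exists s => // i im.
  by rewrite !(eqP (s0 _ (mem_nth _ _))) ?addr0 // ss; lia.
have : (prodXB s).[- x] = 0.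
  rewrite -eW horner_prodXD.
  by apply/eqP; rewrite prodf_seq_eq0; apply/hasP; exists x; rewrite //= addNr.
rewrite horner_prodXB => /eqP; rewrite prodf_seq_eq0 => /hasP [y ys] /=.
rewrite subr_eq0 => /eqP y_x.
(* As x is nonzero in characteristic zero, -x differs from x and survives the removal of x. *)
have ys' : y \in rem x s.
  have := perm_to_rem xs => /perm_mem /(_ y); rewrite ys inE => /esym /orP [/eqP e|//].
  by move: x0; rewrite /= -eqNr y_x e eqxx.
have ps : perm_eq s [:: x, y & rem y (rem x s)].
  by rewrite (perm_trans (perm_to_rem xs)) // perm_cons perm_to_rem.
have ss' : size (rem y (rem x s)) = (2 * m)%N.
  by move: (perm_size ps); rewrite ss /=; lia.
have [|t pt ht] := IH _ ss'.
  move: eW; rewrite /prodXD /prodXB !(perm_big _ ps) /= !big_cons -y_x.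
  rewrite polyCN opprK !mulrA [('X - _) * ('X + _)]mulrC.
  by apply: mulfI; rewrite mulf_neq0 // ?polyXsubC_eq0 // -[x]opprK polyCN polyXsubC_eq0.
exists [:: x, y & t].
  by rewrite perm_sym (perm_trans ps) // !perm_cons perm_sym.
case=> [_|i im]; first by rewrite /= -y_x subrr.
by rewrite mulnS /= ht.
Qed.

Local Open Scope nat_scope.

(** * New primes *)

Definition pair_sum (s : seq int) (a b : nat) : nat := `|(s`_a + s`_b)%R|.

Definition pair_diff (s : seq int) (a b : nat) : nat := `|(s`_a - s`_b)%R|.

(** A single product, so that old primes are recognised by one divisibility. For [r <= i] it depends
    only on the first [i] entries ([modulus_take]), so it is known when entry [i] is chosen. *)
Definition modulus (r : nat) (s : seq int) (i : nat) : nat :=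
  (\prod_(a < i) \prod_(b < i | b != a) pair_sum s a b) *
  (\prod_(a < r) \prod_(b < r | b != a) pair_diff s a b).

Lemma dvdn_prod2 (F : nat -> nat -> nat) (i a b : nat) :
  a < i -> b < i -> a != b -> F a b %| \prod_(a < i) \prod_(b < i | b != a) F a b.
Proof.
move=> ai bi ab; rewrite (bigD1 (Ordinal ai)) // dvdn_mulr //=.
by rewrite (bigD1 (Ordinal bi)) ?dvdn_mulr // -val_eqE /= eq_sym.
Qed.

Lemma modulus_take (r : nat) (s : seq int) (i : nat) :
  r <= i -> modulus r (take i s) i = modulus r s i.
Proof.
move=> ri; congr (_ * _); apply: eq_bigr => a _; apply: eq_bigr => b _.
  by rewrite /pair_sum !nth_take.
by rewrite /pair_diff !nth_take // (leq_trans _ ri).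
Qed.

Lemma leq_prod_const (I : finType) (P : pred I) (F : I -> nat) (X : nat) :
  0 < X -> (forall i, P i -> F i <= X) -> \prod_(i | P i) F i <= X ^ #|I|.
Proof.
move=> X0 h; apply: (@leq_trans (\prod_(i | P i) X)); first exact: leq_prod.
rewrite big_const iter_muln_1 leq_pexp2l //; exact: max_card.
Qed.

(** Any polynomial bound suffices, since the modulus enters the count only through an arbitrarily
    small power. *)
Lemma modulus_bound (r : nat) (s : seq int) (i X : nat) :
  0 < X -> r <= i -> (forall a, a < i -> `|(s`_a)%R| <= X) ->
  modulus r s i <= (2 * X) ^ (2 * i ^ 2).
Proof.
move=> X0 ri h; have X20 : 0 < 2 * X by rewrite muln_gt0.
have hs a b : a < i -> b < i -> pair_sum s a b <= 2 * X.
  by move=> /h ha /h hb; rewrite /pair_sum; lia.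
have hd a b : a < i -> b < i -> pair_diff s a b <= 2 * X.
  by move=> /h ha /h hb; rewrite /pair_diff; lia.
have P F m : m <= i -> (forall a b, a < i -> b < i -> F a b <= 2 * X) ->
  \prod_(a < m) \prod_(b < m | b != a) F a b <= (2 * X) ^ (i ^ 2).
  move=> mi hF; apply: (@leq_trans (((2 * X) ^ i) ^ i)); last by rewrite -expnM.
  apply: leq_trans (leq_prod_const (X := (2 * X) ^ i) _ _) _.
  - by rewrite expn_gt0 X20.
  - move=> a _; apply: leq_trans (leq_prod_const (X := 2 * X) X20 _) _.
      by move=> b _; apply: hF; apply: leq_trans mi.
    by rewrite card_ord leq_pexp2l.
  by rewrite card_ord leq_pexp2l // expn_gt0 X20.
rewrite /modulus [2 * i ^ 2]mul2n -addnn expnD.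
by apply: leq_mul; apply: P.
Qed.

Lemma modulus_gt0 (r : nat) (s : seq int) (i : nat) :
  (forall a b, a < i -> b < i -> a != b -> 0 < pair_sum s a b) ->
  (forall a b, a < r -> b < r -> a != b -> (s`_a != s`_b)%R) ->
  0 < modulus r s i.
Proof.
move=> hs hd; rewrite muln_gt0; apply/andP; split.
  by apply: prodn_cond_gt0 => a _; apply: prodn_cond_gt0 => b ba; rewrite hs // eq_sym.
apply: prodn_cond_gt0 => a _; apply: prodn_cond_gt0 => b ba.
by rewrite /pair_diff absz_gt0 subr_eq0 hd // eq_sym.
Qed.

Lemma prod_primes_leq (m : nat) : 0 < m -> \prod_(l <- primes m) l <= m.
Proof.
move=> m0; rewrite {2}(prod_prime_decomp m0) /primes big_map.
rewrite big_seq [X in _ <= X]big_seq; apply: leq_prod => -[p e] /mem_prime_decomp.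
case=> pp e0 _ /=; rewrite -{1}[p]expn1 leq_pexp2l // prime_gt0 //.
Qed.

(* A prime is new at (i, p) if it divides z_i + z_p but not the modulus of
   the first i coordinates; this happens for at most one pair (i, p). *)
Definition new_prime (r : nat) (s : seq int) (p l : nat) : bool :=
  [exists i : 'I_(size s), [&& r <= i, l %| pair_sum s p i & ~~ (l %| modulus r s i)]].

(** If [l] is new at (i, p) and at (j, q) with i < j, it divides z_p + z_i, a factor of the modulus
    at j. If i = j and p, q differ, it divides (z_p + z_i) - (z_q + z_i) = z_p - z_q, again a factor
    of the modulus. *)
Lemma new_prime_inj (r : nat) (s : seq int) (p q l : nat) :
  p < r -> q < r -> new_prime r s p l -> new_prime r s q l -> p = q.
Proof.
move=> pr qr /existsP [i /and3P [ri li ni]] /existsP [j /and3P [rj lj nj]].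
have dvd_lt (a b x : nat) : x < r -> r <= a -> a < b -> l %| pair_sum s x a -> l %| modulus r s b.
  move=> xr ra ab /dvdn_trans -> //; rewrite dvdn_mulr //.
  have xa : (x < a)%N := leq_trans xr ra.
  by apply: dvdn_prod2 => //; [exact: ltn_trans ab | rewrite neq_ltn xa].
have [ij|ij|/val_inj ij] := ltngtP i j.
- by rewrite (dvd_lt i j p) in nj.
- by rewrite (dvd_lt j i q) in ni.
subst j; apply/eqP/negPn/negP => pq; case/negP: ni.
apply: dvdn_mull; apply: (@dvdn_trans (pair_diff s p q)); last exact: dvdn_prod2.
have dvdE (x : int) : (l %| `|x|) = (l%:Z %| x)%Z by rewrite dvdzE.
move: li lj; rewrite /pair_sum /pair_diff !dvdE => li lj.
have -> : (s`_p - s`_q = (s`_p + s`_i) - (s`_q + s`_i))%R by ring.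
exact: rpredB.
Qed.

(** [b] is the least of the [r] products [B p] of the primes of [U] that are new for [p]. By
    [new_prime_inj] these products together use each prime of [U] at most once, so b^r is at most
    [U]. *)
Lemma exists_small_new_part (r X : nat) (s : seq int) :
  0 < r <= size s ->
  (forall a b, a < size s -> b < size s -> a != b -> 0 < pair_sum s a b <= X) ->
  (forall a b, a < r -> b < r -> a != b -> (s`_a != s`_b)%R) ->
  (forall a b, a < size s -> b < size s ->
     \prod_(i < size s | i != a :> nat) pair_sum s a i =
     \prod_(i < size s | i != b :> nat) pair_sum s b i) ->
  exists p b, [/\ p < r, 0 < b, b ^ r <= X ^ (size s - r) &
    forall i l, r <= i < size s -> prime l -> l %| pair_sum s p i ->
      l %| b * modulus r s i].
Proof.
move=> /andP [r0 rs] hs hd hp.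
pose U := \prod_(r <= i < size s) pair_sum s 0 i.
have s0 : 0 < size s by apply: leq_trans rs.
have UE : U = \prod_(i < size s | r <= i) pair_sum s 0 i.
  rewrite /U big_geq_mkord /=.
  by [].
have ltr i : r <= i -> 0 != i by move=> ri; rewrite neq_ltn (leq_trans r0 ri).
have U0 : 0 < U.
  rewrite UE; apply: prodn_cond_gt0 => i ri.
  by have /andP[] := hs 0 i s0 (ltn_ord i) (ltr _ ri).
have UX : U <= X ^ (size s - r).
  rewrite /U; apply: (@leq_trans (\prod_(r <= i < size s) X)).
    rewrite big_nat_cond [X in _ <= X]big_nat_cond; apply: leq_prod => i.
    rewrite andbT => /andP [ri ilt].
    by have /andP[] := hs 0 i s0 ilt (ltr _ ri).
  by rewrite prod_nat_const_nat.
pose B p := \prod_(l <- primes U) (if new_prime r s p l then l else 1).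
have B0 p : 0 < B p.
  rewrite /B big_seq; apply: prodn_cond_gt0 => l; rewrite mem_primes => /and3P [pl _ _].
  by case: ifP => // _; exact: prime_gt0.
have BU : \prod_(p < r) B p <= U.
  rewrite /B exchange_big /=; apply: leq_trans (prod_primes_leq U0).
  rewrite big_seq [X in _ <= X]big_seq; apply: leq_prod => l.
  rewrite mem_primes => /and3P [pl _ _].
  have [p np|no] := pickP (fun p : 'I_r => new_prime r s p l).
    rewrite (bigD1 p) //= np big1 ?muln1 // => q qp.
    case: ifP => // nq; case/negP: qp; apply/eqP/val_inj.
    exact: (@new_prime_inj r s q p l).
  rewrite big1 ?prime_gt0 // => q _.
  by case: ifP => // nq; have := no q; rewrite /= nq.
have [p _ pmin] := arg_minnP (fun q : 'I_r => B q) (isT : predT (Ordinal r0)).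
exists p, (B p); split=> //.
  apply: leq_trans UX; apply: leq_trans BU.
  rewrite -[X in _ ^ X](card_ord r) -prod_nat_const; apply: leq_prod => q _.
  exact: pmin.
move=> i l /andP [ri ilt] pl li.
have [lm|lm] := boolP (l %| modulus r s i); first by rewrite dvdn_mull.
have np : new_prime r s p l by apply/existsP; exists (Ordinal ilt); rewrite /= ri li lm.
apply: dvdn_mulr.
have plt : p < size s by exact: leq_trans (ltn_ord p) rs.
(* The new prime divides z_p + z_i, hence, by the equality of the products, some z_0 + z_j. For j <
   r this sum would be a factor of the modulus; so j >= r, and the prime divides [U]. *)
suff lU : l \in primes U.
  by rewrite /B (bigD1_seq l) ?primes_uniq //= np dvdn_mulr.
rewrite mem_primes pl U0 /=.
have : l %| \prod_(j < size s | j != p :> nat) pair_sum s p j.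
  rewrite (bigD1 (Ordinal ilt)) ?dvdn_mulr //=.
  by rewrite neq_ltn (leq_trans (ltn_ord p) ri) orbT.
rewrite (hp _ _ plt s0) Euclid_dvd_prod // big_orE => /existsP [j /andP [j0 lj]].
have [rj|jr] := leqP r j.
  by rewrite UE (bigD1 j) // dvdn_mulr.
case/negP: lm; apply: dvdn_mulr; apply: dvdn_trans lj _.
by apply: dvdn_prod2; [exact: leq_trans ri | exact: leq_trans jr ri | rewrite eq_sym].
Qed.

(** * Enumeration of the nontrivial solutions *)

Definition smooth (K X : nat) : seq nat :=
  [seq w <- iota 1 X | all (fun l => l %| K) (primes w)].

Lemma mem_smooth (K X w : nat) : 0 < w <= X ->
  (forall l, prime l -> l %| w -> l %| K) -> w \in smooth K X.
Proof.
move=> /andP [w0 wX] h; rewrite mem_filter mem_iota w0 add1n ltnS wX !andbT.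
by apply/allP => l; rewrite mem_primes => /and3P [pl _]; exact: h.
Qed.

Lemma size_allpairs_dep_leq (S : eqType) (T U : Type) (f : S -> T -> U)
    (s : seq S) (t : S -> seq T) (M : nat) :
  {in s, forall x, size (t x) <= M} ->
  size [seq f x y | x <- s, y <- t x] <= size s * M.
Proof.
elim: s => //= x s IH h; rewrite size_cat size_map mulSn leq_add ?h ?mem_head //.
by apply: IH => y ys; apply: h; rewrite inE ys orbT.
Qed.

Definition box (N : nat) : seq int :=
  [seq (i%:Z - N%:Z)%R | i <- iota 0 (2 * N + 1)].

Lemma size_box (N : nat) : size (box N) = 2 * N + 1.
Proof. by rewrite size_map size_iota. Qed.

Lemma mem_box (N : nat) (x : int) : `|x| <= N -> x \in box N.
Proof.
move=> xN; apply/mapP; exists (absz (x + N%:Z)%R); last by lia.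
by rewrite mem_iota; lia.
Qed.

Fixpoint words (T : Type) (A : seq T) (m : nat) : seq (seq T) :=
  if m is m'.+1 then [seq x :: w | x <- A, w <- words A m'] else [:: [::]].

Lemma size_words (T : Type) (A : seq T) (m : nat) :
  size (words A m) = size A ^ m.
Proof. by elim: m => //= m IH; rewrite size_allpairs IH expnS. Qed.

Lemma mem_words (T : eqType) (A : seq T) (w : seq T) :
  all (mem A) w -> w \in words A (size w).
Proof.
elim: w => //= x w IH /andP [xA wA].
by apply: allpairs_f => //; exact: IH.
Qed.

(** [t] lists the [d] available values, and [f] gives the position in [t] of each of the [n]
    entries. *)
Definition few_values (n d N : nat) : seq (seq int) :=
  [seq [seq (t`_j)%R | j <- f] | t <- words (box N) d, f <- words (iota 0 d) n].

Lemma size_few_values (n d N : nat) :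
  size (few_values n d N) = (2 * N + 1) ^ d * d ^ n.
Proof. by rewrite size_allpairs !size_words size_box size_iota. Qed.

Lemma mem_few_values (d N : nat) (s : seq int) :
  all (fun x : int => `|x| <= N) s -> size (undup s) <= d ->
  s \in few_values (size s) d N.
Proof.
(* Padding with zeros gives exactly [d] values; zero lies in every box. *)
move=> sN sd; pose t := undup s ++ nseq (d - size (undup s)) 0%R.
have st : size t = d by rewrite size_cat size_nseq subnKC.
have -> : s = [seq (t`_j)%R | j <- [seq index x (undup s) | x <- s]].
  rewrite -map_comp -[LHS]map_id; apply/eq_in_map => x xs /=.
  by rewrite nth_cat index_mem mem_undup xs nth_index // mem_undup.
apply: allpairs_f.
  rewrite -st; apply: mem_words; rewrite all_cat; apply/andP; split.
    by apply/allP => x; rewrite mem_undup => /(allP sN); exact: mem_box.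
  by apply/allP => x; rewrite mem_nseq => /andP [_ /eqP ->]; exact: mem_box.
have -> : size [seq (t`_j)%R | j <- [seq index x (undup s) | x <- s]]
  = size [seq index x (undup s) | x <- s] by rewrite size_map.
apply: mem_words; apply/allP => j /mapP [x xs ->].
by rewrite /= mem_iota add0n (leq_trans _ sd) // index_mem mem_undup.
Qed.

(** Each [w] is a possible value of |z_i + z_p|, and the two lists account for its sign. The guard
    makes one bound on [smooth K] valid for all prefixes, including those that come from no
    solution. *)
Definition extensions (r p b N T : nat) (s : seq int) (i : nat) : seq int :=
  let K := b * modulus r s i in
  if 0 < K <= T then
    [seq (w%:Z - s`_p)%R | w <- smooth K (2 * N)] ++
    [seq (- w%:Z - s`_p)%R | w <- smooth K (2 * N)]
  else [::].

(** Sequences grow at the right end because the choices for an entry [j >= r] depend on the prefix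
    through its modulus. *)
Fixpoint candidates (r p b N T i : nat) : seq (seq int) :=
  if i is j.+1 then
    [seq rcons s x | s <- candidates r p b N T j,
                     x <- if j < r then box N else extensions r p b N T s j]
  else [:: [::]].

Lemma size_candidates (r p b N T M m : nat) :
  (forall K, 0 < K <= T -> 2 * size (smooth K (2 * N)) <= M) ->
  size (candidates r p b N T (r + m)) <= (2 * N + 1) ^ r * M ^ m.
Proof.
move=> hM; elim: m => [|m IH].
  rewrite addn0 muln1.
  suff h i : i <= r -> size (candidates r p b N T i) <= (2 * N + 1) ^ i by exact: h.
  elim: i => // i IH ir; rewrite expnSr /=.
  apply: leq_trans (size_allpairs_dep_leq _ (M := 2 * N + 1) _) _.
    by move=> s _; rewrite ir size_box.
  by rewrite leq_mul2r IH ?orbT // ltnW.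
rewrite addnS expnSr mulnA /=.
apply: leq_trans (size_allpairs_dep_leq _ (M := M) _) _; last first.
  by rewrite leq_mul2r IH orbT.
move=> s _; rewrite ltnNge leq_addr /= /extensions.
by case: ifP => // hK; rewrite size_cat !size_map addnn -mul2n hM.
Qed.

Lemma mem_candidates (r p b N T : nat) (s : seq int) : p < r ->
  all (fun x : int => `|x| <= N) s ->
  (forall i, r <= i < size s -> [/\ 0 < b * modulus r s i <= T, 0 < pair_sum s p i &
    forall l, prime l -> l %| pair_sum s p i -> l %| b * modulus r s i]) ->
  s \in candidates r p b N T (size s).
Proof.
move=> pr sN h.
suff H i : i <= size s -> take i s \in candidates r p b N T i.
  by have := H _ (leqnn _); rewrite take_size.
elim: i => [|i IH] ilt; first by rewrite take0 mem_head.
rewrite (take_nth 0%R) //=; apply: allpairs_f_dep; first exact/IH/ltnW.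
have hN a : a < size s -> `|(s`_a)%R| <= N.
  by move=> alt; apply: (allP sN); exact: mem_nth.
case: ltnP => ri; first exact/mem_box/hN.
have /h [hK hp hl] : r <= i < size s by rewrite ri.
rewrite /extensions modulus_take // hK nth_take ?(leq_trans pr) //.
have pN : pair_sum s p i <= 2 * N.
  have plt : p < size s by exact: ltn_trans (leq_trans pr ri) ilt.
  by have := hN _ ilt; have := hN _ plt; rewrite /pair_sum; lia.
have ws : pair_sum s p i \in smooth (b * modulus r s i) (2 * N).
  by apply: mem_smooth hl; rewrite hp.
rewrite mem_cat; have [s0|s0] := lerP 0%R (s`_p + s`_i)%R.
  by apply/orP; left; apply/mapP; exists (pair_sum s p i); rewrite // /pair_sum gez0_abs //; ring.
by apply/orP; right; apply/mapP; exists (pair_sum s p i); rewrite // /pair_sum ltz0_abs //; ring.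
Qed.

(** The pairs run over the possible [p] and new parts [b]; the permutation [sg] undoes the
    rearrangement that puts [r] distinct values first. *)
Definition many_values (n r N Y T : nat) : seq (seq int) :=
  [seq [seq (t`_((sg : {perm 'I_n}) i))%R | i <- enum 'I_n] |
     t <- flatten [seq candidates r pb.1 pb.2 N T n |
                   pb <- [seq (p, b) | p <- iota 0 r, b <- iota 1 Y]],
     sg <- enum {perm 'I_n}].

Lemma size_many_values (n r N Y T M : nat) : r <= n ->
  (forall K, 0 < K <= T -> 2 * size (smooth K (2 * N)) <= M) ->
  size (many_values n r N Y T) <=
    r * Y * ((2 * N + 1) ^ r * M ^ (n - r)) * n`!.
Proof.
move=> rn hM; rewrite size_allpairs -cardT card_Sn leq_mul2r; apply/orP; right.
have -> : r * Y = size [seq (p, b) | p <- iota 0 r, b <- iota 1 Y].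
  by rewrite size_allpairs !size_iota.
elim: [seq (p, b) | p <- _, b <- _] => //= pb l IH.
rewrite size_cat mulSn leq_add //.
by have := size_candidates r pb.1 pb.2 (n - r) hM; rewrite subnKC.
Qed.

(** * Covering the nontrivial solutions by the two lists *)

Lemma perm_distinct_prefix (s : seq int) (r : nat) : r <= size (undup s) ->
  exists2 t, perm_eq s t &
    forall a b, a < r -> b < r -> a != b -> (t`_a != t`_b)%R.
Proof.
move=> rs; have [rest ps] := perm_to_subseq (undup_subseq s).
exists (undup s ++ rest) => // a b ar br ab.
by rewrite !nth_cat !(leq_trans _ rs) // nth_uniq ?undup_uniq // (leq_trans _ rs).
Qed.

(* Since c / 2 is the common value of the products of the z_i + z_j over
   i <> j, the condition c <> 0 excludes exactly the trivial solutions. *)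
Definition nontrivial (n N : nat) (s : seq int) : Prop :=
  [/\ size s = n, all (fun x : int => `|x| <= N) s &
   exists2 c : int, c != 0%R & (prodXD s - prodXB s = c *: 'X)%R].

Lemma nontrivial_perm (n N : nat) (s t : seq int) :
  perm_eq s t -> nontrivial n N s -> nontrivial n N t.
Proof.
move=> st [sn sN [c c0 hc]]; split; first by rewrite -(perm_size st).
  by rewrite -(perm_all _ st).
by exists c => //; rewrite -hc /prodXD /prodXB !(perm_big _ st).
Qed.

Lemma nontrivial_pair_sum (n N : nat) (s : seq int) : ~~ odd n -> 0 < N ->
  nontrivial n N s ->
  (forall a b, a < n -> b < n -> a != b -> 0 < pair_sum s a b <= 2 * N) /\
  (forall a b, a < n -> b < n ->
     \prod_(i < n | i != a :> nat) pair_sum s a i =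
     \prod_(i < n | i != b :> nat) pair_sum s b i).
Proof.
move=> en N0 [sn sN [c c0 hc]]; rewrite -sn in en *; split => [a b alt blt ab|a b alt blt].
  have hN i : i < size s -> `|(s`_i)%R| <= N by move=> ?; apply: (allP sN); exact: mem_nth.
  apply/andP; split; last by have := hN _ alt; have := hN _ blt; rewrite /pair_sum; lia.
  rewrite absz_gt0; apply: contra_neq c0 => h.
  exact: (prod_pair_sum_eq0 en hc alt blt ab h).
have absP (j : nat) : \prod_(i < size s | i != j :> nat) pair_sum s j i
    = `|(\prod_(i < size s | i != j :> nat) (s`_j + s`_i))%R|.
  by rewrite (big_morph absz abszM (erefl : `|1%R| = 1)).
rewrite !absP; congr absz; apply: (@mulfI _ 2%:R%R) => //.
by rewrite !(prod_pair_sum en hc).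
Qed.

(** Fewer than [r] distinct values put [s] in [few_values]. Otherwise [exists_small_new_part]
    applies to a rearrangement with distinct first [r] entries, whose pair sums are at most 2N, and
    makes it a candidate. *)
Lemma nontrivial_cover (n r N Y : nat) (s : seq int) : ~~ odd n -> 0 < N ->
  0 < r <= n -> (forall b, b ^ r <= (2 * N) ^ (n - r) -> b <= Y) ->
  nontrivial n N s ->
  s \in few_values n r.-1 N ++ many_values n r N Y ((2 * N) ^ (n + 2 * n ^ 2)).
Proof.
move=> en N0 /andP [r0 rn] hY hs; rewrite mem_cat.
have [rs|sr] := leqP r (size (undup s)); last first.
  case: hs => <- sN _; rewrite mem_few_values //.
  by rewrite -ltnS prednK.
apply/orP; right.
have [t st td] := perm_distinct_prefix rs.
have ht := nontrivial_perm st hs.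
have [hsum hprod] := nontrivial_pair_sum en N0 ht.
have [tn tN _] := ht; have [sn _ _] := hs.
have [] := @exists_small_new_part r (2 * N) t; rewrite ?tn ?r0 //.
move=> p [b [pr b0 bX hb]].
have N20 : 0 < 2 * N by rewrite muln_gt0.
have tc : t \in candidates r p b N ((2 * N) ^ (n + 2 * n ^ 2)) n.
  rewrite -tn; apply: mem_candidates => // i; rewrite tn => /andP [ri ilt]; split.
  - rewrite muln_gt0 b0 modulus_gt0 //=; last first.
      by move=> a a' alt a'lt; have := hsum a a' (ltn_trans alt ilt) (ltn_trans a'lt ilt);
         move=> h /h /andP[].
    (* The exponent [n] absorbs [b <= b ^ r <= (2 * N) ^ (n - r)], and [2 * n ^ 2] absorbs the
       modulus. *)
    rewrite expnD; apply: leq_mul.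
      apply: (@leq_trans (b ^ r)); first by rewrite -{1}[b]expn1 leq_pexp2l.
      by apply: leq_trans bX _; rewrite leq_pexp2l // leq_subr.
    apply: leq_trans (modulus_bound N0 ri _) _.
      by move=> a ai; apply: (allP tN); apply: mem_nth; rewrite tn (ltn_trans ai).
    by rewrite leq_pexp2l // leq_mul2l leq_exp2r // ltnW.
  - have plt : p < n by exact: ltn_trans (leq_trans pr ri) ilt.
    have pi : p != i by rewrite neq_ltn (leq_trans pr ri).
    by have /andP[] := hsum p i plt ilt pi.
  - by move=> l; apply: hb; rewrite ri ilt.
have : perm_eq s (in_tuple t) by [].
move=> /tuple_permP [sg es].
have te : size t = n by [].
rewrite -te in tc sg es *.
have -> : s = [seq (t`_(sg i : 'I_(size t)))%R | i <- enum 'I_(size t)].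
  by rewrite es; apply: eq_map => i; rewrite (tnth_nth 0%R).
apply: (@allpairs_f _ _ _
  (fun t' (sg : {perm 'I_(size t)}) => [seq (t'`_(sg i))%R | i <- enum 'I_(size t)])).
  apply/flattenP; exists (candidates r p b N ((2 * N) ^ (size t + 2 * size t ^ 2)) (size t)).
    apply/mapP; exists (p, b) => //.
    by apply: allpairs_f; rewrite mem_iota ?add0n // b0 add1n ltnS hY.
  by [].
by rewrite mem_enum.
Qed.

Local Open Scope classical_set_scope.
Local Open Scope ring_scope.

(** * Integers composed of prescribed primes *)

(** For positive [K] and [ls = primes K] this is [smooth K X]; an explicit list of primes permits
    induction on it. *)
Definition smooth_over (ls : seq nat) (X : nat) : seq nat :=
  [seq w <- iota 1 X | all (mem ls) (primes w)].

(** The multiples of [l] are the l v with v <= X / l still composed of [l :: ls]; the other elements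
    are composed of [ls] alone. *)
Lemma size_smooth_over_cons (l : nat) (ls : seq nat) (X : nat) : prime l ->
  (size (smooth_over (l :: ls) X) <=
   size (smooth_over ls X) + size (smooth_over (l :: ls) (X %/ l)))%N.
Proof.
move=> pl; rewrite -[X in (_ <= _ + X)%N](size_map (muln l)) -size_cat.
apply: uniq_leq_size; first by rewrite filter_uniq // iota_uniq.
move=> w; rewrite mem_filter mem_iota add1n ltnS => /andP [hw /andP [w0 wX]].
rewrite mem_cat; apply/orP.
have [/dvdnP [v ev]|nl] := boolP (l %| w)%N.
  right; apply/mapP; exists v; last by rewrite ev mulnC.
  have v0 : (0 < v)%N by move: w0; rewrite ev muln_gt0 => /andP[].
  rewrite mem_filter mem_iota v0 add1n ltnS leq_divRL ?prime_gt0 // -ev wX !andbT.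
  apply/allP => q; rewrite mem_primes => /and3P [pq _ qv].
  apply: (allP hw); rewrite mem_primes pq w0 ev.
  exact: dvdn_mulr.
left; rewrite mem_filter mem_iota w0 add1n ltnS wX !andbT.
apply/allP => q qw; have := allP hw _ qw; rewrite /= inE => /orP [/eqP ql|//].
by move: qw nl; rewrite mem_primes ql => /and3P [_ _ ->].
Qed.

Lemma one_powR (R : realType) (x : R) : 1 `^ x = 1.
Proof. by rewrite powR1. Qed.

(** The sum of l^(-j eps) over j >= 0, which is the factor at [l] of the series of w^(-eps) over the
    integers w composed of given primes. *)
Definition euler_factor (R : realType) (eps : R) (l : nat) : R :=
  (1 - (l%:R `^ eps)^-1)^-1.

Lemma powR_nat_gt1 (R : realType) (eps : R) (l : nat) :
  0 < eps -> (1 < l)%N -> 1 < l%:R `^ eps.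
Proof.
move=> eps0 l1.
rewrite -[ltLHS](one_powR eps) gt0_ltr_powR // ?nnegrE ?ler0n ?ler01 //.
by rewrite ltr1n.
Qed.

Lemma euler_factor_gt0 (R : realType) (eps : R) (l : nat) :
  0 < eps -> (1 < l)%N -> 0 < euler_factor eps l.
Proof.
move=> eps0 /(powR_nat_gt1 eps0) l1; rewrite invr_gt0 subr_gt0 invf_lt1 //.
exact: lt_trans l1.
Qed.

Lemma euler_factorE (R : realType) (eps : R) (l : nat) :
  0 < eps -> (1 < l)%N ->
  1 + euler_factor eps l * (l%:R `^ eps)^-1 = euler_factor eps l.
Proof.
move=> eps0 /(powR_nat_gt1 eps0); rewrite /euler_factor; move: (_ `^ _) => t t1.
have t0 : t != 0 by lra.
have t2 : t - 1 != 0 by lra.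
by field; rewrite t0 t2.
Qed.

(** Induction on the list, then strong induction on [X]. With E the factor at [l] and A the product
    of the others, [size_smooth_over_cons] gives A X^eps + E A (X/l)^eps, which is E A X^eps by
    [euler_factorE]. Over the empty list only w = 1 can occur. *)
Lemma size_smooth_over (R : realType) (eps : R) (ls : seq nat) (X : nat) :
  0 < eps -> all prime ls ->
  (size (smooth_over ls X))%:R <= \prod_(l <- ls) euler_factor eps l * X%:R `^ eps.
Proof.
move=> eps0; elim: ls X => [|l ls IH] X.
  move=> _; rewrite big_nil mul1r.
  have [->|X0] := posnP X; first exact: powR_ge0.
  apply: (@le_trans _ _ 1).
    rewrite lern1; apply: (@leq_trans (size [:: 1%N])) => //.
    apply: uniq_leq_size; first by rewrite filter_uniq // iota_uniq.
    move=> w; rewrite mem_filter mem_iota => /andP [hw /andP [w0 _]].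
    rewrite inE; have [//|w1] := leqP w 1; first by move=> h; rewrite eqn_leq h.
    by have /(allP hw) : pdiv w \in primes w by rewrite mem_primes pdiv_prime // w0 pdiv_dvd.
  by rewrite -[leLHS](one_powR eps) ge0_ler_powR ?nnegrE ?ler0n ?ler01 ?ler1n // ltW.
rewrite /= big_cons => /andP [pl pls].
have l1 := prime_gt1 pl.
elim/ltn_ind: X => X IHX.
have A0 : 0 <= \prod_(q <- ls) euler_factor eps q.
  rewrite big_seq; apply: prodr_ge0 => q /(allP pls) /prime_gt1 q1.
  exact/ltW/euler_factor_gt0.
have c0 := euler_factor_gt0 eps0 l1.
have [->|X0] := posnP X.
  apply: (@le_trans _ _ 0) => //; apply: mulr_ge0; last exact: powR_ge0.
  by apply: mulr_ge0 => //; exact: ltW.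
set A := \prod_(_ <- _) _ in A0 IH IHX *.
apply: (@le_trans _ _ (A * X%:R `^ eps +
    euler_factor eps l * A * (X%:R `^ eps * (l%:R `^ eps)^-1))).
  apply: (@le_trans _ _ ((size (smooth_over ls X))%:R
      + (size (smooth_over (l :: ls) (X %/ l)))%:R)).
    by rewrite -natrD ler_nat size_smooth_over_cons.
  apply: lerD; first exact: IH.
  apply: le_trans (IHX _ (ltn_Pdiv l1 X0)) _.
  apply: ler_wpM2l; first by apply: mulr_ge0 => //; exact: ltW.
  have lX : (X %/ l)%:R <= X%:R / l%:R :> R.
    by rewrite ler_pdivlMr ?ltr0n ?prime_gt0 // -natrM ler_nat leq_trunc_div.
  rewrite -[_^-1]powR_inv1 ?powR_ge0 // -powRrM mulrC [eps * _]mulrC powRrM.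
  rewrite powR_inv1 // mulrC -powRM ?invr_ge0 //.
  by rewrite ge0_ler_powR ?nnegrE ?divr_ge0 // ltW.
rewrite [leLHS](_ : _ = (1 + euler_factor eps l * (l%:R `^ eps)^-1) * (A * X%:R `^ eps));
  last by ring.
by rewrite euler_factorE // mulrA.
Qed.

(** If t = l^eps >= 2, the factor t / (t - 1) is at most t. Each of the boundedly many smaller
    primes costs at most an extra constant [D]. The product of the l^eps is at most K^eps. *)
Lemma prod_euler_factor_bound (R : realType) (eps : R) : 0 < eps ->
  exists2 C : R, 0 < C &
  forall K : nat, (0 < K)%N -> \prod_(l <- primes K) euler_factor eps l <= C * K%:R `^ eps.
Proof.
(* Euler factors decrease in [l], so [D] is the largest; [m] exceeds 2^(1/eps), so l^eps >= 2 once l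
   >= m. *)
move=> eps0; pose D := euler_factor eps 2; pose m := (Num.truncn ((2 : R) `^ eps^-1)).+1.
have D1 : 1 <= D.
  by rewrite /D -euler_factorE // lerDl mulr_ge0 // ?ltW ?euler_factor_gt0 //
    invr_gt0 (lt_trans _ (powR_nat_gt1 eps0 _)).
exists (D ^+ m); first by rewrite exprn_gt0 // (lt_le_trans ltr01).
move=> K K0.
have cl l : (1 < l)%N -> euler_factor eps l <= l%:R `^ eps * (if (l < m)%N then D else 1).
  move=> l1; have lp := powR_nat_gt1 eps0 l1; case: ltnP => lm.
    apply: (@le_trans _ _ D).
      have p2 : 1 < 2%:R `^ eps :> R by exact: powR_nat_gt1.
      have d0 (t : R) : 1 < t -> 0 < 1 - t^-1.
        by move=> t1; rewrite subr_gt0 invf_lt1 // (lt_trans ltr01).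
      rewrite /D /euler_factor lef_pV2 ?posrE ?d0 // lerD2l lerN2.
      rewrite lef_pV2 ?posrE ?(lt_trans ltr01) //.
      by apply: ge0_ler_powR; rewrite ?nnegrE ?ler0n ?ler_nat ?(ltW eps0).
    by rewrite ler_peMl ?(le_trans ler01) // ltW.
  have : 2 <= l%:R `^ eps :> R.
    have e2 : 2 = ((2 : R) `^ eps^-1) `^ eps.
      by rewrite -powRrM mulVf ?powRr1 // gt_eqF.
    rewrite [leLHS]e2.
    apply: ge0_ler_powR; rewrite ?nnegrE ?powR_ge0 ?ler0n ?(ltW eps0) //.
    by apply: ltW; apply: lt_le_trans (truncnS_gt _) _; rewrite ler_nat.
  rewrite mulr1 /euler_factor; move: (_ `^ _) lp => t t1 t2.
  have -> : (1 - t^-1)^-1 = t / (t - 1) by field; apply/andP; split; lra.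
  by rewrite ler_pdivrMr ?subr_gt0 //; nra.
apply: (@le_trans _ _ (\prod_(l <- primes K) (l%:R `^ eps * (if (l < m)%N then D else 1)))).
  rewrite big_seq [leRHS]big_seq; apply: ler_prod => l.
  by rewrite mem_primes => /and3P [/prime_gt1 l1 _ _]; rewrite cl // ltW // euler_factor_gt0.
rewrite big_split /= mulrC; apply: ler_pM.
- by apply: prodr_ge0 => l _; case: ifP => // _; apply: le_trans D1.
- by apply: prodr_ge0 => l _; exact: powR_ge0.
- rewrite -big_mkcond big_const_seq iter_mulr_1 ler_weXn2l //.
  rewrite -size_filter; apply: (@leq_trans (size (iota 0 m))); last by rewrite size_iota.
  apply: uniq_leq_size; first by rewrite filter_uniq // primes_uniq.
  by move=> l; rewrite mem_filter mem_iota => /andP [].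
apply: (@le_trans _ _ ((\prod_(l <- primes K) l)%:R `^ eps)).
  elim: (primes K) => [|l ls IH]; first by rewrite !big_nil one_powR.
  by rewrite !big_cons natrM powRM // ler_wpM2l ?powR_ge0.
by rewrite ge0_ler_powR ?nnegrE ?ler0n ?ler_nat ?prod_primes_leq // ltW.
Qed.

(* Rankin's trick; in particular it contains the divisor bound. *)
Lemma size_smooth_bound (R : realType) (eps : R) : 0 < eps ->
  exists2 C : R, 0 < C & forall K X : nat, (0 < K)%N ->
    (size (smooth K X))%:R <= C * (K%:R * X%:R) `^ eps.
Proof.
move=> eps0; have [C C0 hC] := prod_euler_factor_bound eps0.
exists C => // K X K0.
have -> : smooth K X = smooth_over (primes K) X.
  apply: eq_in_filter => w _; apply: eq_in_all => l.
  by rewrite /= !mem_primes => /and3P [-> _ _]; rewrite K0.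
apply: le_trans (size_smooth_over X eps0 _) _.
  by apply/allP => l; rewrite mem_primes => /and3P[].
by rewrite powRM // mulrA ler_wpM2r ?powR_ge0 // hC.
Qed.

(** * The bound for V - L *)

Definition ivec_tuple (k : nat) (z : ivec k) : (2 * k).+2.-tuple int :=
  [tuple z i | i < (2 * k).+2].

Lemma ivec_tuple_inj (k : nat) :
  injective (fun z : ivec k => tval (ivec_tuple z)).
Proof.
move=> y z /val_inj e; apply/ffunP => i.
by have := congr1 (fun t => tnth t i) e; rewrite !tnth_mktuple.
Qed.

(** If c were 0, [prodXD] and [prodXB] would agree, and the resulting pairing of the entries gives a
    permutation that puts [z] on a [paired_space]. *)
Lemma nontrivial_ivec (R : realType) (k : nat) (P : R) (z : ivec k) : 0 <= P ->
  (solutions P `\` trivial_solutions P) z ->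
  nontrivial (2 * k).+2 (Num.truncn P) (ivec_tuple z).
Proof.
move=> P0 [[zsys zbox] ztriv].
have st : size (ivec_tuple z) = (2 * k).+2 by rewrite size_tuple.
split=> //.
  apply/allP => x /mapP [i _ ->]; have := zbox i.
  by rewrite -abszE truncn_ge_nat.
have hs m : (m < k)%N -> \sum_(x <- ivec_tuple z) x ^+ (2 * m + 1) = 0.
  move=> mk; rewrite /= big_map big_enum /=.
  have := zsys m.+1; rewrite ltnS leq0n mk => /(_ isT).
  by have -> : (2 * m.+1 - 1 = 2 * m + 1)%N by lia.
have [c hc] := prodXD_sub_prodXB st hs.
exists c => //; apply/eqP => c0; apply: ztriv; split=> //.
move: hc; rewrite c0 scale0r => /eqP; rewrite subr_eq0 => /eqP eAB.
have st' : size (ivec_tuple z) = (2 * k.+1)%N by rewrite st; lia.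
have [t /tuple_permP [s et] ht] := pairing_of_prodXD_eq st' eAB.
have zt (j : nat) : (j < (2 * k).+2)%N -> z (s (inord j)) = t`_j.
  move=> jk; rewrite et (nth_map ord0) ?size_enum_ord // tnth_mktuple.
  congr (z (s _)); apply/val_inj; rewrite /= inordK //.
  by rewrite nth_enum_ord.
exists s => // i /andP [i1 ik].
rewrite !zt; [|lia|lia].
have := ht i.-1; have -> : (2 * i.-1 = (2 * i - 1).-1)%N by lia.
have -> : ((2 * i - 1).-1.+1 = (2 * i).-1)%N by lia.
by apply; lia.
Qed.

(** Trivial solutions are solutions, so V - L counts the set difference. The inequality [L <= V] is
    recorded because subtraction of naturals truncates. *)
Lemma V_sub_L_leq_size (R : realType) (k : nat) (P : R) (l : seq (seq int)) :
  0 <= P ->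
  (forall s, nontrivial (2 * k).+2 (Num.truncn P) s -> s \in l) ->
  (L k P <= V k P)%N /\ (V k P - L k P <= size l)%N.
Proof.
move=> P0 hl.
have fs := @finite_solutions R k P.
have ft := @finite_trivial_solutions R k P.
have sub : (fset_set (@trivial_solutions R k P) `<=` fset_set (@solutions R k P))%fset.
  apply/fsubsetP => z.
  by rewrite (in_fset_set ft) (in_fset_set fs) !inE => -[].
split; first exact: fsubset_leq_card.
rewrite /V /L -cardfsDS //.
rewrite cardfE -cardfE /= -(size_map (fun z : ivec k => tval (ivec_tuple z))).
apply: uniq_leq_size.
  rewrite map_inj_uniq ?fset_uniq //; exact: ivec_tuple_inj.
move=> s /mapP [z hz ->]; apply: hl; apply: nontrivial_ivec => //.
move: hz; rewrite inE (in_fset_set ft) (in_fset_set fs) => /andP [nt hs].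
by split; [exact: set_mem | move=> /mem_set; exact/negP].
Qed.

(** [few_values] contributes O(P^(r-1)). In [many_values] the prefix costs P^r, the new part [b]
    costs P^((n-r)/r), and all further entries together cost P^eps. *)
Lemma V_sub_L_bound (R : realType) (k r : nat) (eps : R) : 0 < eps ->
  (2 <= r <= 2 * k + 1)%N ->
  exists2 C : R, 0 < C & forall P : R, 1 <= P ->
    `|(V k P)%:R - (L k P)%:R| <= C * P `^ (alpha_term R k r + eps).
Proof.
move=> eps0 /andP [r2 rk].
pose n := (2 * k).+2; pose m := (n - r)%N; pose e := (n + 2 * n ^ 2)%N.
have r_gt0 : (0 < r)%N by exact: ltnW.
have rn : (r <= n)%N by rewrite /n; lia.
(* Each of the at most [n] further entries has O((K * 2N)^d) choices with K <= (2N)^e, that is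
   O(Q^(d(e + 1))); this [d] keeps their product within O(Q^eps). *)
have [d d0 dE] : exists2 d : R, 0 < d & d * ((e + 1) * n)%:R = eps.
  have en0 : 0 < ((e + 1) * n)%:R :> R by rewrite ltr0n /n; lia.
  by exists (eps / ((e + 1) * n)%:R); rewrite ?divr_gt0 // divfK // gt_eqF.
have [C0 C00 hC0] := size_smooth_bound d0.
(* The first term comes from [few_values], the second from [many_values]. The further factor 3^a
   below converts powers of [Q = 3 * P] into powers of [P]. *)
pose C1 : R := (r.-1 ^ n)%:R + (r * n`!)%:R * (2 * C0) ^+ m.
have C10 : 0 < C1.
  apply: ltr_wpDl => //; apply: mulr_gt0; first by rewrite ltr0n muln_gt0 fact_gt0; lia.
  by rewrite exprn_gt0 // mulr_gt0.
pose a := alpha_term R k r + eps.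
exists (C1 * 3 `^ a); first by rewrite mulr_gt0 // powR_gt0.
move=> P P1; have P0 : 0 <= P by rewrite (le_trans ler01).
pose N := Num.truncn P.
have N0 : (0 < N)%N by rewrite truncn_gt0.
have NP : N%:R <= P by rewrite truncn_le.
have N1 : 1 <= N%:R :> R by rewrite ler1n.
pose Q := 3 * P.
have Q1 : 1 <= Q by rewrite /Q; lra.
have Q0 : 0 <= Q by rewrite (le_trans ler01).
have NQ : (2 * N + 1)%:R <= Q by rewrite natrD natrM /Q; lra.
have NQ' : (2 * N)%:R <= Q by apply: le_trans NQ; rewrite ler_nat leq_addr.
pose M := Num.truncn (2 * C0 * Q `^ (d * (e + 1)%:R)).
pose Y := Num.truncn (Q `^ (m%:R / r%:R)).
have M0 : 0 <= 2 * C0 * Q `^ (d * (e + 1)%:R) by rewrite mulr_ge0 ?powR_ge0 // mulr_ge0 // ltW.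
have hM K : (0 < K <= (2 * N) ^ e)%N -> (2 * size (smooth K (2 * N)) <= M)%N.
  move=> /andP [K0 KT]; rewrite truncn_ge_nat // natrM -mulrA ler_pM2l //.
  apply: le_trans (hC0 _ _ K0) _; rewrite ler_pM2l // [d * (e + 1)%:R]mulrC [Q `^ _]powRrM.
  apply: ge0_ler_powR; rewrite ?nnegrE ?powR_ge0 ?mulr_ge0 ?(ltW d0) //.
  rewrite powR_mulrn // addn1 exprSr; apply: ler_pM => //.
  apply: (@le_trans _ _ ((2 * N) ^ e)%:R); first by rewrite ler_nat.
  by rewrite natrX lerXn2r // nnegrE.
have hY b : (b ^ r <= (2 * N) ^ (n - r))%N -> (b <= Y)%N.
  move=> hb; rewrite truncn_ge_nat ?powR_ge0 // powRrM powR_mulrn //.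
  have r0 : r%:R != 0 :> R by rewrite pnatr_eq0 -lt0n.
  have bE : b%:R = (b%:R ^+ r) `^ (r%:R^-1) :> R.
    by rewrite -powR_mulrn // -powRrM mulfV // powRr1.
  rewrite [leLHS]bE.
  apply: ge0_ler_powR; rewrite ?nnegrE ?exprn_ge0 ?invr_ge0 //.
  rewrite -natrX; apply: (@le_trans _ _ ((2 * N) ^ m)%:R); first by rewrite ler_nat.
  by rewrite natrX lerXn2r // nnegrE.
have nodd : ~~ odd n by rewrite /n /= negbK mul2n odd_double.
have r0n : (0 < r <= n)%N by rewrite r_gt0.
have [LV] := V_sub_L_leq_size P0 (fun s => @nontrivial_cover n r N Y s nodd N0 r0n hY).
rewrite size_cat size_few_values => hVL.
rewrite -natrB // ger0_norm //.
apply: (@le_trans _ _ ((2 * N + 1) ^ r.-1 * r.-1 ^ n +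
    r * Y * ((2 * N + 1) ^ r * M ^ m) * n`!)%:R).
  by rewrite ler_nat (leq_trans hVL) // leq_add2l size_many_values.
(* Since m = n - r, the quotient m/r is n/r - 1, which accounts for the -1 in [alpha_term]. *)
have aE : a = r%:R + m%:R / r%:R + eps.
  rewrite /a /alpha_term /m natrB // mulrBl divff ?pnatr_eq0 -?lt0n //.
  by rewrite /n -addn2; ring.
have hr : (r.-1)%:R <= a.
  rewrite aE -addrA; apply: (@le_trans _ _ r%:R); first by rewrite ler_nat leq_pred.
  by rewrite lerDl addr_ge0 ?divr_ge0 // ltW.
have MR : M%:R ^+ m <= (2 * C0) ^+ m * Q `^ eps.
  apply: (@le_trans _ _ ((2 * C0 * Q `^ (d * (e + 1)%:R)) ^+ m)).
    by rewrite lerXn2r ?nnegrE // truncn_le.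
  rewrite exprMn ler_wpM2l ?exprn_ge0 ?mulr_ge0 ?(ltW C00) //.
  rewrite -powR_mulrn ?powR_ge0 // -powRrM; apply: ler_powR => //.
  by rewrite -dE -mulrA -natrM ler_pM2l // ler_nat leq_mul // leq_subr.
have YR : Y%:R <= Q `^ (m%:R / r%:R) by rewrite truncn_le powR_ge0.
have QX j : ((2 * N + 1) ^ j)%:R <= Q `^ j%:R by rewrite natrX powR_mulrn // lerXn2r // nnegrE.
have QP : Q `^ a = 3 `^ a * P `^ a by rewrite powRM.
rewrite -mulrA -QP /C1 mulrDl natrD; apply: lerD.
  rewrite natrM mulrC ler_wpM2l //; apply: le_trans (QX _) _.
  exact: ler_powR.
have Qn0 : Q != 0 by rewrite gt_eqF // (lt_le_trans ltr01).
rewrite aE !powRD ?Qn0 ?implybT //.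
rewrite [leLHS](_ : _ = (r * n`!)%:R * (Y%:R * (((2 * N + 1) ^ r)%:R * M%:R ^+ m))); last first.
  by rewrite -[M%:R ^+ m]natrX !natrM; ring.
rewrite [leRHS](_ : _ = (r * n`!)%:R * (Q `^ (m%:R / r%:R) *
    (Q `^ r%:R * ((2 * C0) ^+ m * Q `^ eps)))); last by ring.
rewrite ler_wpM2l //; apply: ler_pM YR _ => //.
exact: ler_pM (QX r) MR.
Qed.

(** * Comparison of the exponent with the square root *)

Lemma oblong_bracket (n : nat) : exists r, (r * r.-1 <= n < r * r.+1)%N.
Proof.
elim: n => [|n [r hr]]; first by exists 1%N.
have [h|h] := ltnP n.+1 (r * r.+1)%N; first by exists r; nia.
by exists r.+1; rewrite /=; nia.
Qed.

(** Take r with r(r - 1) <= 2k + 2 < r(r + 1). Then x = (2k + 2)/r differs from r by at most 1, so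
    (r + x)^2 = 4rx + (r - x)^2 <= 4(2k + 2) + 1 = 8k + 9. *)
Lemma alpha_le_sqrt (R : realType) (k : nat) : (2 <= k)%N ->
  alpha R k <= Num.sqrt (8 * k + 9)%:R - 1.
Proof.
move=> k2; have [r hr] := oblong_bracket (2 * k + 2).
have r2 : (2 <= r)%N by rewrite ltnNge; apply/negP => r1; nia.
have rk : (r <= 2 * k + 1)%N by rewrite leqNgt; apply/negP => h; nia.
apply: (@le_trans _ _ (alpha_term R k r)); first by apply: alpha_le; rewrite r2.
rewrite /alpha_term addrAC lerD2r.
have r0 : 0 < r%:R :> R by rewrite ltr0n; lia.
set x := _ / _; have xr : x * r%:R = (2 * k + 2)%:R by rewrite mulfVK // gt_eqF.
have x0 : 0 <= x by rewrite divr_ge0.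
have [h1 h2] := andP hr.
have x1 : r%:R - 1 <= x.
  have -> : r%:R - 1 = r.-1%:R :> R by rewrite -subn1 natrB // ltnW.
  by rewrite -(ler_pM2r r0) xr -natrM ler_nat mulnC.
have x2 : x <= r%:R + 1.
  by rewrite -(ler_pM2r r0) xr natr1 -natrM ler_nat [leqRHS]mulnC ltnW.
have n0 : 0 <= r%:R + x by rewrite addr_ge0.
have -> : r%:R + x = Num.sqrt ((r%:R + x) ^+ 2) by rewrite sqrtr_sqr ger0_norm.
apply: ler_wsqrtr.
have -> : (8 * k + 9)%:R = 4 * (x * r%:R) + 1 :> R.
  by rewrite xr -natrM natr1; congr _%:R; lia.
by nra.
Qed.


Theorem theorem1p1 (R : realType) (k : nat) (hk : (2 <= k)%N)
    (eps : R) (heps : 0 < eps) :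
  (exists2 C : R, 0 < C & \forall P \near +oo,
     `|(V k P)%:R - (L k P)%:R| <= C * P `^ (alpha R k + eps))
  /\
  (exists2 C : R, 0 < C & \forall P \near +oo,
     `|(V k P)%:R - (L k P)%:R|
       <= C * P `^ (Num.sqrt (8 * k + 9)%:R - 1 + eps)).
Proof.
(* The bound for one minimising [r] gives both claims, for every P >= 1; the second follows as
   powers of P increase with the exponent. *)
have [r hr ar] := alpha_attained R (ltnW hk).
have [C C0 hC] := V_sub_L_bound heps hr.
split; exists C => //; near=> P.
  by rewrite ar; apply: hC; near: P; exact: nbhs_pinfty_ge.
have P1 : 1 <= P by near: P; exact: nbhs_pinfty_ge.
apply: le_trans (hC P P1) _; rewrite ler_pM2l //.
by apply: ler_powR => //; rewrite lerD2r -ar; exact: alpha_le_sqrt.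
Unshelve. all: by end_near.
Qed.
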